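(* Let $n\ge 4$ and let $A$ be a nonempty subset of $[n]=\{1,\dots,n\}$ such that $QJ(n,A)$ has at least 4 vertices. Then $QJ(n,A)$ is paired 2-coverable.
   Context: The Johnson graph $J(n,k)$ has as vertices the $k$-subsets of $[n]$, two being adjacent iff they share exactly $k-1$ elements. For a nonempty $A=\{a_1<a_2<\dots<a_m\}\subseteq[n]$, the graph $QJ(n,A)$ is formed by taking, for each $i$, a copy of $J(n,a_i)$ (called level $i$), and additionally joining a vertex $u$ of level $i$ to a vertex $v$ of level $i+1$ whenever $u\subseteq v$ (for $1\le i<m$); there are no other edges. A graph $G$ is \emph{paired 2-coverable} if for any four distinct vertices $u,v,x,y$ of $G$ there exist two vertex-disjoint paths $P$ and $Q$ in $G$ such that $P$ has endpoints $u$ and $v$, $Q$ has endpoints $x$ and $y$, and $V(P)\cup V(Q)=V(G)$. *)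

(* Defs.v *)
From mathcomp Require Import all_boot.
Set Implicit Arguments. Unset Strict Implicit. Unset Printing Implicit Defensive.

(* Ground set [n] = {1,...,n} is represented by 'I_n (element i <-> i+1).
   A subset A of [n] is given as a set of naturals A : {set 'I_n.+1}
   (value k <-> the number k) with 0 \notin A. *)

Definition QJvert (n : nat) (A : {set 'I_n.+1}) :=
  {S : {set 'I_n} | (inord #|S| : 'I_n.+1) \in A}.

Definition next_in (n : nat) (A : {set 'I_n.+1}) (a b : nat) : bool :=
  [&& (inord a : 'I_n.+1) \in A, (inord b : 'I_n.+1) \in A, a < b, a <= n, b <= n &
      [forall c : 'I_n.+1, (c \in A) ==> ~~ ((a < c) && (c < b))]].

Definition QJadj (n : nat) (A : {set 'I_n.+1}) : rel (QJvert A) :=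
  fun u v =>
    let S := val u in let T := val v in
    [|| (#|S| == #|T|) && (#|S :&: T| == #|S|.-1) && (S != T),
        next_in A #|S| #|T| && (S \subset T)
      | next_in A #|T| #|S| && (T \subset S)].

Definition is_path (T : finType) (e : rel T) (x y : T) (p : seq T) : bool :=
  [&& path e x p, last x p == y & uniq (x :: p)].

Definition paired_2_coverable (T : finType) (e : rel T) : Prop :=
  forall u v x y : T, uniq [:: u; v; x; y] ->
    exists p q : seq T,
      [/\ is_path e u v p, is_path e x y q,
          [disjoint (u :: p) & (x :: q)] &
          forall w : T, (w \in u :: p) || (w \in x :: q)].

(* Main.v *)
Require Import Defs.
From mathcomp Require Import all_boot zify.

Set Implicit Arguments.
Unset Strict Implicit.
Unset Printing Implicit Defensive.

(**
The statement is proved for every interval [L, U] of a Boolean lattice of sets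
with #|U :\: L| >= 4, restricted to the levels in A, as soon as some level of A
lies strictly between #|L| and #|U| (levels #|L| and #|U| themselves are
allowed).  The proof is by induction on #|U :\: L|: an element i of U :\: L cuts
the interval into [L, U :\ i] and [i |: L, U], and path systems of the halves
are glued along edges between them.  If all four ends lie in one half, the first
edge of a path is rerouted through a Hamiltonian path of the other half;
otherwise the path of each separated pair crosses exactly once.  Enough
crossing edges exist because every vertex other than L has two neighbours in the
other half, and on a suitable level three, with distinct neighbourhoods.  The
gluing fails only when #|L|.+1 (or dually #|U|.-1) is the sole intermediate
level; the graph is then complete up to one edge, and vertices are inserted one
at a time.  The case #|U :\: L| = 4 is a finite search.
*)

Ltac split_neq := rewrite /= ?inE ?negb_or;
  repeat match goal with
  | H : is_true (uniq (_ :: _)) |- _ => progress (rewrite /= ?inE ?negb_or in H)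
  | H : is_true (_ \notin _ :: _) |- _ => progress (rewrite ?inE ?negb_or in H)
  | H : is_true (_ && _) |- _ =>
      let H1 := fresh "neq" in let H2 := fresh "neq" in case/andP: H => H1 H2
  end.

(* Closes [uniq] and [\notin] goals on explicit sequences from such facts. *)
Ltac neq_solve := split_neq; repeat (apply/andP; split);
  first [done | by rewrite eq_sym].

(** * Covers by two paths *)

Section Trails.

Variables (X : eqType) (e : rel X).
Implicit Types (u v x y z w : X) (s t : seq X) (V : pred X).

Definition trail u v s := exists p, [/\ s = u :: p, path e u p & last u p = v].

Lemma trail1 u : trail u u [:: u].
Proof. by exists [::]. Qed.

Lemma trail_cat u v x y s t :
  trail u v s -> e v x -> trail x y t -> trail u y (s ++ t).
Proof.
case=> p [-> pp lp] evx [q [-> qq lq]]; exists (p ++ x :: q).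
by rewrite cat_path last_cat /= pp lp evx qq lq.
Qed.

Lemma trail_rev u v s : symmetric e -> trail u v s -> trail v u (rev s).
Proof.
move=> e_sym [p [-> pp <-]]; exists (rev (belast u p)); split.
- by rewrite lastI rev_rcons.
- by rewrite rev_path; under eq_path do rewrite e_sym.
- by case: p {pp} => //= a p; rewrite rev_cons last_rcons.
Qed.

Lemma trail_behead u v s : u != v -> trail u v s ->
  exists z t, [/\ s = u :: t, e u z & trail z v t].
Proof.
move=> uv [[|z p] [-> //=]]; first by move=> _ /eqP; rewrite (negPf uv).
case/andP=> euz pp lp; exists z, (z :: p); split=> //; by exists p.
Qed.

Lemma trail_head u v s : trail u v s -> u \in s.
Proof. by case=> p [-> _ _]; rewrite mem_head. Qed.

Lemma trail_last u v s : trail u v s -> v \in s.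
Proof. by case=> p [-> _ <-]; rewrite mem_last. Qed.

(* Multiplicities encode disjointness, simplicity and covering at once. *)
Definition linked V u v x y := exists s t,
  [/\ trail u v s, trail x y t &
      forall w, count_mem w s + count_mem w t = V w].

Definition spanned V u v := exists2 s, trail u v s &
  forall w, count_mem w s = V w.

Definition linkable V := forall u v x y, V u -> V v -> V x -> V y ->
  uniq [:: u; v; x; y] -> linked V u v x y.

Definition spannable V := forall u v, V u -> V v -> u != v -> spanned V u v.

Lemma linkedC V u v x y : linked V u v x y -> linked V x y u v.
Proof. by case=> s [t [us xt c]]; exists t, s; split=> // w; rewrite addnC. Qed.

Lemma linked_rev V u v x y :
  symmetric e -> linked V u v x y -> linked V v u x y.
Proof.
move=> es [s [t [us xt c]]]; exists (rev s), t; split=> //.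
  exact: trail_rev.
by move=> w; rewrite count_rev.
Qed.

Lemma eq_linkable V V' : V =1 V' -> linkable V -> linkable V'.
Proof.
move=> eqV lV u v x y; rewrite -!eqV => Vu Vv Vx Vy un.
have [s [t [us xt c]]] := lV u v x y Vu Vv Vx Vy un.
by exists s, t; split=> // w; rewrite -eqV.
Qed.

Lemma count_mem_indicator (V : pred X) s t :
  (forall w, count_mem w s + count_mem w t = V w) ->
  {in s ++ t, forall w, V w} /\ uniq (s ++ t).
Proof.
move=> c; split=> [w|].
  by rewrite -has_pred1 has_count count_cat c lt0b.
apply: count_mem_uniq => w; rewrite -has_pred1 has_count count_cat c.
by case: (V w).
Qed.

(** A first linking supplies a neighbour [z] of [x] different from [u] and [v]. A second one links
    [u] to [x] and [z] to [v], and the edge from [x] to [z] joins its two paths into one. *)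
Lemma linkable_spannable V : symmetric e ->
  (forall u v, exists x y, [/\ V x, V y & u != v -> uniq [:: u; v; x; y]]) ->
  linkable V -> spannable V.
Proof.
move=> es four lV u v Vu Vv uv.
have [x [y [Vx Vy /(_ uv) un]]] := four u v.
have [s [t [us xt c]]] := lV u v x y Vu Vv Vx Vy un.
have [inV unst] := count_mem_indicator c.
have xy : x != y by neq_solve.
have [z [t' [t_eq exz zt]]] := trail_behead xy xt.
have zt' := trail_head zt; have us0 := trail_head us; have vs := trail_last us.
have Vz : V z by apply: inV; rewrite t_eq mem_cat inE zt' !orbT.
have un' : uniq [:: u; x; z; v].
  move: unst; rewrite t_eq cat_uniq /=.
  case/and3P=> _ /norP[xs /hasPn/(_ _ zt') /= zs] /andP[xt' _].
  have ux : u != x by apply: contraNneq xs => <-.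
  have vx : v != x by apply: contraNneq xs => <-.
  have uz : u != z by apply: contraNneq zs => <-.
  have vz : v != z by apply: contraNneq zs => <-.
  have xz : x != z by apply: contraNneq xt' => ->.
  by clear -uv ux vx uz vz xz; neq_solve.
have [s1 [t1 [us1 zt1 c1]]] := lV u x z v Vu Vx Vz Vv un'.
exists (s1 ++ t1); first exact: trail_cat us1 exz zt1.
by move=> w; rewrite count_cat.
Qed.

End Trails.

(** * Gluing path systems of two halves *)

Section Join.

Variables (X : eqType) (e : rel X).
Hypothesis e_sym : symmetric e.

(** Serves the case of four ends in [V0]: a detour through [V1] needs two distinct vertices to enter
    and leave by. *)
Definition distinct_ends (V0 V1 : pred X) := forall s t, V0 s -> V0 t ->
  s != t -> exists s' t', [/\ V1 s', V1 t', s' != t', e s s' & e t t'].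

(** Serves the case of three ends in [V0]: [z] becomes the fourth end there, and [z' != y] since
    only distinct vertices of [V1] are joined by a spanning path. *)
Definition exit_avoiding (V0 V1 : pred X) := forall u v x y,
  V0 u -> V0 v -> V0 x -> V1 y -> exists z z',
  [/\ V0 z, V1 z', z \notin [:: u; v; x], z' != y & e z z'].

(** Serves the case of two separated pairs, where each path crosses by its own edge and each half is
    left with four distinct ends. *)
Definition two_exits (V0 V1 : pred X) := forall u x v y,
  V0 u -> V0 x -> V1 v -> V1 y -> exists z w z' w',
  [/\ [/\ V0 z, V0 w, V1 z' & V1 w'], u != x -> uniq [:: z; w; u; x],
      v != y -> uniq [:: z'; w'; v; y], e z z' & e w w'].

Section Half.

Variables (V V0 V1 : pred X).
Hypothesis V01 : forall w, nat_of_bool (V w) = V0 w + V1 w.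
Hypothesis linked0 : linkable e V0.
Hypothesis linked1 : linkable e V1.
Hypothesis spanned0 : spannable e V0.
Hypothesis spanned1 : spannable e V1.

(** The edge from [u] to its successor [z] is replaced by the detour [u], [u'], a Hamiltonian path
    of [V1], [z'], [z]. *)
Lemma linked_one_side : distinct_ends V0 V1 ->
  forall u v x y, V0 u -> V0 v -> V0 x -> V0 y -> uniq [:: u; v; x; y] ->
  linked e V u v x y.
Proof.
move=> dist u v x y Vu Vv Vx Vy un.
have [s [t [us xt c]]] := linked0 Vu Vv Vx Vy un.
have uv : u != v by neq_solve.
have [z [s' [s_eq euz zs]]] := trail_behead uv us.
have [inV unst] := count_mem_indicator c.
have zs' := trail_head zs.
have Vz : V0 z by apply: inV; rewrite s_eq mem_cat inE zs' !orbT.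
have uz : u != z.
  by move: unst; rewrite s_eq /= mem_cat => /andP[/norP[]]; case: eqP => // ->;
    rewrite zs'.
have [u' [z' [Vu' Vz' uz' euu' ezz']]] := dist u z Vu Vz uz.
have [r ur cr] := spanned1 Vu' Vz' uz'.
exists ([:: u] ++ (r ++ s')), t; split=> //.
- apply: (trail_cat (trail1 e u) euu').
  by apply: trail_cat ur _ zs; rewrite e_sym.
- by move=> w; move: (c w) (cr w); rewrite V01 s_eq; clear; rewrite !count_cat /=; lia.
Qed.

Lemma linked_three_one : exit_avoiding V0 V1 ->
  forall u v x y, V0 u -> V0 v -> V0 x -> V1 y -> uniq [:: u; v; x; y] ->
  linked e V u v x y.
Proof.
move=> ext u v x y Vu Vv Vx Vy un.
have [z [z' [Vz Vz' zn zy ezz]]] := ext _ _ _ _ Vu Vv Vx Vy.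
have un' : uniq [:: u; v; x; z].
  by clear -un zn; neq_solve.
have [s [t [us xt c]]] := linked0 Vu Vv Vx Vz un'.
have [r zr cr] := spanned1 Vz' Vy zy.
exists s, (t ++ r); split=> //; first exact: trail_cat xt ezz zr.
by move=> w; move: (c w) (cr w); rewrite V01; clear; rewrite !count_cat; lia.
Qed.

Lemma linked_two_two u v x y : V0 u -> V0 v -> V1 x -> V1 y ->
  uniq [:: u; v; x; y] -> linked e V u v x y.
Proof.
move=> Vu Vv Vx Vy un.
have uv : u != v by neq_solve.
have xy : x != y by neq_solve.
have [s us cs] := spanned0 Vu Vv uv; have [t xt ct] := spanned1 Vx Vy xy.
by exists s, t; split=> // w; rewrite cs ct V01.
Qed.

Lemma linked_crossing : two_exits V0 V1 ->
  forall u v x y, V0 u -> V1 v -> V0 x -> V1 y -> uniq [:: u; v; x; y] ->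
  linked e V u v x y.
Proof.
move=> ext u v x y Vu Vv Vx Vy un.
have [z [w [z' [w' [[Vz Vw Vz' Vw'] un0 un1 ezz eww]]]]] :=
  ext _ _ _ _ Vu Vx Vv Vy.
have ux : u != x by neq_solve.
have vy : v != y by neq_solve.
move: {un0}(un0 ux) {un1}(un1 vy) => un0 un1.
have un0' : uniq [:: u; z; x; w] by clear -un0; neq_solve.
have un1' : uniq [:: z'; v; w'; y] by clear -un1; neq_solve.
have [s [t [us xt c]]] := linked0 Vu Vz Vx Vw un0'.
have [s1 [t1 [us1 xt1 c1]]] := linked1 Vz' Vv Vw' Vy un1'.
exists (s ++ s1), (t ++ t1); split.
- exact: trail_cat us ezz us1.
- exact: trail_cat xt eww xt1.
by move=> a; move: (c a) (c1 a); rewrite V01; clear; rewrite !count_cat; lia.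
Qed.
End Half.

Lemma linkable_join (V V0 V1 : pred X) :
  (forall w, nat_of_bool (V w) = V0 w + V1 w) ->
  linkable e V0 -> linkable e V1 -> spannable e V0 -> spannable e V1 ->
  distinct_ends V0 V1 -> distinct_ends V1 V0 ->
  exit_avoiding V0 V1 -> exit_avoiding V1 V0 ->
  two_exits V0 V1 -> linkable e V.
Proof.
move=> V01 l0 l1 s0 s1 d0 d1 e0 e1 f.
have V10 w : nat_of_bool (V w) = V1 w + V0 w by rewrite addnC.
have side w : V w -> V0 w \/ V1 w.
  by move=> Vw; have := V01 w; rewrite Vw; case: (V0 w); [left | case: (V1 w); [right|]].
move=> u v x y /side Vu /side Vv /side Vx /side Vy un.
have un_vu : uniq [:: v; u; x; y] by clear -un; neq_solve.
have un_xy : uniq [:: x; y; u; v] by clear -un; neq_solve.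
have un_xyvu : uniq [:: x; y; v; u] by clear -un; neq_solve.
have un_uvyx : uniq [:: u; v; y; x] by clear -un; neq_solve.
have un_vuyx : uniq [:: v; u; y; x] by clear -un; neq_solve.
have rl u' v' x' y' : linked e V v' u' x' y' -> linked e V u' v' x' y'.
  exact: linked_rev.
have ct u' v' x' y' : linked e V x' y' u' v' -> linked e V u' v' x' y'.
  exact: linkedC.
have rr u' v' x' y' : linked e V u' v' y' x' -> linked e V u' v' x' y'.
  by move=> lk; apply/ct/rl/ct.
have c40 := linked_one_side V01 l0 s1 d0; have c04 := linked_one_side V10 l1 s0 d1.
have c31 := linked_three_one V01 l0 s1 e0; have c13 := linked_three_one V10 l1 s0 e1.
have c22 := linked_two_two V01 s0 s1; have c22' := linked_two_two V10 s1 s0.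
have cs := linked_crossing V01 l0 l1 f.
(* The sixteen placements of the ends reduce to the patterns above by reversing or exchanging paths.
   A separated pair can always be oriented from [V0] to [V1], which is why [two_exits] is required
   in one direction. *)
case: Vu Vv Vx Vy => [Vu|Vu] [Vv|Vv] [Vx|Vx] [Vy|Vy].
- exact: c40.
- exact: c31.
- by apply: rr; apply: c31.
- exact: c22.
- by apply: ct; apply: c31.
- exact: cs.
- by apply: rr; apply: cs.
- by apply: ct; apply: rr; apply: c13.
- by apply: ct; apply: rr; apply: c31.
- by apply: rl; apply: cs.
- by apply: rl; apply: rr; apply: cs.
- by apply: ct; apply: c13.
- exact: c22'.
- by apply: rr; apply: c13.
- exact: c13.
- exact: c04.
Qed.

(** If [z] is an end, its path starts with an edge to some [r] that is none of the other ends.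
    Otherwise [w] lies on only one of the two paths linking the ends in [V'], and [z] fits between
    the first two vertices of the other. *)
Lemma linkable_insert (V V' : pred X) z w :
  (forall a, nat_of_bool (V a) = V' a + (a == z)) ->
  (forall a, V' a -> a != w -> e z a) ->
  (forall a b c, exists r, [/\ V' r, r \notin [:: a; b; c] & e z r]) ->
  linkable e V' -> linkable e V.
Proof.
move=> Vz zw pick lV'.
have V'z : ~~ V' z by have := Vz z; rewrite eqxx; case: (V' z) => //; case: (V z).
have side a : V a -> V' a \/ a = z.
  by move=> Va; have := Vz a; rewrite Va; case: (V' a); [left | case: eqP; [right|]].
have ct u' v' x' y' : linked e V x' y' u' v' -> linked e V u' v' x' y'.
  exact: linkedC.
have rl u' v' x' y' : linked e V v' u' x' y' -> linked e V u' v' x' y'.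
  exact: linked_rev.
have endz v x y : V' v -> V' x -> V' y -> uniq [:: z; v; x; y] ->
    linked e V z v x y.
  move=> Vv Vx Vy un; have [r [Vr rn ezr]] := pick v x y.
  have un' : uniq [:: r; v; x; y] by clear -un rn; neq_solve.
  have [s [t [rs xt c]]] := lV' _ _ _ _ Vr Vv Vx Vy un'.
  exists ([:: z] ++ s), t; split=> //; first exact: trail_cat (trail1 e z) ezr rs.
  by move=> a; move: (c a); rewrite Vz eq_sym; clear; rewrite count_cat /=; lia.
have inner u v x y s t : u != v -> trail e u v s -> trail e x y t ->
    (forall a, count_mem a s + count_mem a t = V' a) ->
    w \notin s -> linked e V u v x y.
  move=> uv us xt c ws; have [a [s' [s_eq eua as']]] := trail_behead uv us.
  have ine b : b \in s -> e z b.
    move=> bs; apply: zw; last by apply: contraNneq ws => <-.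
    by apply: (count_mem_indicator c).1; rewrite mem_cat bs.
  exists ([:: u] ++ ([:: z] ++ s')), t; split=> //.
    apply: (@trail_cat _ _ u u z) (trail1 e u) _ _.
      by rewrite e_sym ine ?(trail_head us).
    apply: trail_cat (trail1 e z) _ (as').
    by rewrite ine // s_eq inE (trail_head as') orbT.
  move=> b; move: (c b); rewrite Vz s_eq (eq_sym b); clear.
  by rewrite !count_cat /=; lia.
have all' u v x y : V' u -> V' v -> V' x -> V' y -> uniq [:: u; v; x; y] ->
    linked e V u v x y.
  move=> Vu Vv Vx Vy un; have [s [t [us xt c]]] := lV' _ _ _ _ Vu Vv Vx Vy un.
  have uv : u != v by clear -un; neq_solve.
  have xy : x != y by clear -un; neq_solve.
  case: (boolP (w \in s)) => ws; last exact: inner us xt c ws.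
  apply: ct; apply: inner xy xt us _ _; first by move=> a; rewrite addnC.
  have := (count_mem_indicator c).2; rewrite cat_uniq => /and3P[_ /hasPn ts _].
  by apply: contraTN ws => /ts.
move=> u v x y Vu Vv Vx Vy un.
have un_vu : uniq [:: v; u; x; y] by clear -un; neq_solve.
have un_xy : uniq [:: x; y; u; v] by clear -un; neq_solve.
have un_yx : uniq [:: y; x; u; v] by clear -un; neq_solve.
case: (side _ Vu) => [V'u|uz]; last first.
  subst u; have nz a : V a -> z != a -> V' a.
    by case/side=> // ->; rewrite eqxx.
  by apply: endz => //; apply: nz => //; clear -un; neq_solve.
case: (side _ Vv) => [V'v|vz]; last first.
  subst v; have nz a : V a -> z != a -> V' a.
    by case/side=> // ->; rewrite eqxx.
  by apply: rl; apply: endz => //; apply: nz => //; clear -un; neq_solve.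
case: (side _ Vx) => [V'x|xz]; last first.
  subst x; have nz a : V a -> z != a -> V' a.
    by case/side=> // ->; rewrite eqxx.
  by apply: ct; apply: endz => //; apply: nz => //; clear -un; neq_solve.
case: (side _ Vy) => [V'y|yz]; last first.
  subst y; have nz a : V a -> z != a -> V' a.
    by case/side=> // ->; rewrite eqxx.
  by apply: ct; apply: rl; apply: endz => //; apply: nz => //; clear -un; neq_solve.
exact: all'.
Qed.

End Join.

(** * Transport along partial bijections *)

Lemma linked_map (X Y : eqType) (e : rel X) (e' : rel Y) (V : pred X)
    (V' : pred Y) (f : X -> Y) (g : Y -> X) :
  (forall x, V x -> V' (f x) /\ g (f x) = x) ->
  (forall y, V' y -> V (g y) /\ f (g y) = y) ->
  (forall x x', V x -> V x' -> e x x' -> e' (f x) (f x')) ->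
  forall u v x y, linked e V u v x y -> linked e' V' (f u) (f v) (f x) (f y).
Proof.
move=> fV gV fe u v x y [s [t [us xt c]]].
have [inV _] := count_mem_indicator c.
have trail_map a b r : {in r, forall z, V z} -> trail e a b r ->
    trail e' (f a) (f b) (map f r).
  move=> Vr [p [r_eq pp lp]]; exists (map f p); split.
  - by rewrite r_eq.
  - rewrite path_map.
    have Vap : all V (a :: p) by apply/allP => z; rewrite -r_eq; apply: Vr.
    by apply: (sub_in_path _ Vap pp) => z z'; apply: fe.
  - by rewrite last_map lp.
exists (map f s), (map f t); split.
- by apply: trail_map us => z zs; apply: inV; rewrite mem_cat zs.
- by apply: trail_map xt => z zt; apply: inV; rewrite mem_cat zt orbT.
- move=> w; rewrite -count_cat -map_cat count_map.
  case: (boolP (V' w)) => V'w.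
    have [Vg fg] := gV _ V'w.
    transitivity (count_mem (g w) (s ++ t)); last by rewrite count_cat c Vg.
    apply: eq_in_count => z /inV Vz /=; have [_ gf] := fV _ Vz.
    by apply/eqP/eqP => [<-|->].
  apply/eqP; rewrite -leqn0 leqNgt -has_count; apply/hasPn => z /inV Vz /=.
  by apply: contraNneq V'w => <-; have [] := fV _ Vz.
Qed.

Lemma linkable_map (X Y : eqType) (e : rel X) (e' : rel Y) (V : pred X)
    (V' : pred Y) (f : X -> Y) (g : Y -> X) :
  (forall x, V x -> V' (f x) /\ g (f x) = x) ->
  (forall y, V' y -> V (g y) /\ f (g y) = y) ->
  (forall x x', V x -> V x' -> e x x' -> e' (f x) (f x')) ->
  linkable e V -> linkable e' V'.
Proof.
move=> fV gV fe lV u v x y V'u V'v V'x V'y un.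
have [[Vu fu] [Vv fv]] := (gV _ V'u, gV _ V'v).
have [[Vx fx] [Vy fy]] := (gV _ V'x, gV _ V'y).
rewrite -fu -fv -fx -fy; apply: linked_map fV gV fe _ _ _ _ _.
apply: lV => //; rewrite (_ : [:: _; _; _; _] = map g [:: u; v; x; y]) //.
rewrite map_inj_in_uniq // => a b; rewrite !inE => /or4P ha /or4P hb gab.
have fg z : [\/ z == u, z == v, z == x | z == y] -> f (g z) = z.
  by case=> /eqP->.
by rewrite -(fg a) // gab fg.
Qed.

(** * Levels and intervals of sets *)

(** The gap condition runs over an explicit list so that the finite search can evaluate it. *)
Definition next_level (A : pred nat) a b :=
  [&& A a, A b, a < b & all (fun c => ~~ A c) (iota a.+1 (b - a.+1))].

Lemma next_levelP (A : pred nat) a b :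
  reflect [/\ A a, A b, a < b & forall c, a < c < b -> ~~ A c]
    (next_level A a b).
Proof.
apply: (iffP and4P) => -[Aa Ab ab gap]; split=> //.
  by move=> c abc; apply: (allP gap); rewrite mem_iota; lia.
by apply/allP => c; rewrite mem_iota => abc; apply: gap; lia.
Qed.

Lemma next_level_exists (A : pred nat) a c : A a -> A c -> a < c ->
  exists2 b, next_level A a b & b <= c.
Proof.
move=> Aa Ac ac; have ex : exists b, A b && (a < b) by exists c; rewrite Ac.
case: (ex_minnP ex) => b /andP[Ab ab] bmin; exists b; last by rewrite bmin ?Ac.
apply/next_levelP; split=> // d /andP[ad db]; apply: contraTN db => Ad.
by rewrite -leqNgt bmin ?Ad.
Qed.

Lemma leq_bin_proper m k : 0 < k < m -> m <= 'C(m, k).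
Proof.
elim: m k => // m IH [//|k] /= km; rewrite binS.
case: (ltngtP k.+1 m) => [km'| |<-]; last by rewrite binn binSn; lia.
  by have := IH k.+1; rewrite km' => /(_ isT); have := bin_gt0 m k; lia.
by lia.
Qed.

Section Sets.

Variable T : finType.
Implicit Types (L U S R P Q B C : {set T}) (A : pred nat) (i j k : T).

Lemma between_exists L U a : L \subset U -> #|L| <= a <= #|U| ->
  exists S, [/\ L \subset S, S \subset U & #|S| = a].
Proof.
move=> LU; elim: a => [|a IH] /andP[la ah].
  by exists L; split=> //; lia.
move: la; rewrite leq_eqVlt => /orP[/eqP la|la]; first by exists L.
have [S [LS SU cS]] := IH ltac:(lia).
have /properP[_ [i iU iS]] : S \proper U by rewrite properEcard SU cS.
exists (i |: S); split.
- by apply: subset_trans LS _; apply: subsetUr.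
- by rewrite subUset sub1set iU.
- by rewrite cardsU1 iS cS.
Qed.

(** By [leq_bin_proper], an inner level of an interval of dimension at least 4 has at least 4
    members, so three can be avoided. *)
Lemma level_avoiding L U a (r : seq {set T}) : L \subset U ->
  #|L| < a < #|U| -> #|L| + 4 <= #|U| -> size r <= 3 ->
  exists S, [/\ L \subset S, S \subset U, #|S| = a & S \notin r].
Proof.
move=> LU aLU dim szr.
set D := U :\: L.
have cD : #|D| = #|U| - #|L| by rewrite cardsD (setIidPr LU).
pose W := [set L :|: B | B in [set B : {set T} | B \subset D & #|B| == a - #|L|]].
have disj (B : {set T}) : B \subset D -> [disjoint L & B].
  by rewrite /D subsetD disjoint_sym => /andP[].
have cW : 4 <= #|W|.
  rewrite card_in_imset ?cards_draws.
    by apply: leq_trans (leq_bin_proper _); rewrite cD; lia.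
  move=> B B'; rewrite !inE => /andP[BD _] /andP[B'D _] eqB.
  have simp (C : {set T}) : C \subset D -> (L :|: C) :\: L = C.
    move=> CD; rewrite setDUl setDv set0U; apply/setDidPl.
    by rewrite disjoint_sym disj.
  by rewrite -(simp B) // eqB simp.
have /subsetPn[S /imsetP[B]] : ~~ (W \subset [set S in r]).
  apply/negP => /subset_leq_card; rewrite cardsE => cWr.
  by have := leq_trans cW (leq_trans cWr (card_size r)); rewrite leqNgt ltnS szr.
rewrite !inE => /andP[BD /eqP cB] -> Sr; exists (L :|: B); split=> //.
- exact: subsetUl.
- by rewrite subUset LU (subset_trans BD (subsetDl _ _)).
- by rewrite cardsU disjoint_setI0 ?disj // cards0 cB; lia.
Qed.

(** Independent of [L] and [U], so both halves of an interval carry the same relation. *)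
Definition adj A : rel {set T} := fun S R =>
  [|| (#|S| == #|R|) && (#|S :&: R| == #|S|.-1) && (S != R),
      next_level A #|S| #|R| && (S \subset R)
    | next_level A #|R| #|S| && (R \subset S)].

Lemma adj_sym A : symmetric (adj A).
Proof.
move=> S R; rewrite /adj; congr orb; last by rewrite orbC.
by rewrite [S == R]eq_sym [S :&: R]setIC; case: eqVneq => // ->.
Qed.

Lemma adj_swap A S i j : i \notin S -> j \in S -> adj A S (i |: S :\ j).
Proof.
move=> iS jS; have ij : i != j by apply: contraNneq iS => ->.
have cS : #|S| = #|S :\ j|.+1 by rewrite (cardsD1 j S) jS.
have cR : #|i |: S :\ j| = #|S|.
  by rewrite cardsU1 !inE (negPf iS) andbF cS.
apply/or3P; constructor 1; rewrite cR eqxx /=; apply/andP; split.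
  rewrite setIUr (_ : S :&: [set i] = set0) ?set0U.
    by rewrite (setIidPr (subsetDl _ _)) cS.
  by apply/setP => x; rewrite !inE andbC; case: eqP => // ->; rewrite (negPf iS).
by apply: contraNneq iS => ->; rewrite setU11.
Qed.

Lemma adj_up A S R : next_level A #|S| #|R| -> S \subset R -> adj A S R.
Proof. by move=> SR sub; rewrite /adj SR sub orbT. Qed.

(** The levels of the complements. Subtraction is truncated, so arguments above [#|T|] all read
    [A 0]; this is why level bounds accompany dualization. *)
Definition dual A a := A (#|T| - a).

Lemma next_level_dual A a b : a <= #|T| -> b <= #|T| ->
  next_level A a b -> next_level (dual A) (#|T| - b) (#|T| - a).
Proof.
move=> aT bT /next_levelP[Aa Ab ab gap]; rewrite /dual; apply/next_levelP.
rewrite !subKn //; split=> //; first by lia.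
by move=> c cab; apply: gap; lia.
Qed.

Lemma card_setC S : #|~: S| = #|T| - #|S|.
Proof. by rewrite [in RHS](cardsCs S) subKn ?max_card. Qed.

Lemma adj_setC A S R : adj A S R -> adj (dual A) (~: S) (~: R).
Proof.
have cm Q : #|Q| <= #|T| by apply: max_card.
case/or3P=> [/andP[/andP[/eqP cSR cap] SR]|/andP[lev sub]|/andP[lev sub]];
  apply/or3P.
- constructor 1; rewrite !card_setC cSR eqxx /= (inj_eq (can_inj (@setCK _))) SR andbT.
  move/eqP: cap; rewrite cSR => cap; rewrite -setCU card_setC cardsU cSR cap.
  (* The predecessor in the size of the intersection is truncated at 0; two distinct sets of equal
     size cannot be empty. *)
  have : 0 < #|R|.
    rewrite lt0n cards_eq0; apply: contraNneq SR => R0.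
    by rewrite R0 -cards_eq0 cSR R0 cards0.
  by have := cm (S :|: R); rewrite cardsU cSR cap; move: #|R| #|T| => r n; clear; lia.
- by constructor 3; rewrite !card_setC setCS sub next_level_dual.
- by constructor 2; rewrite !card_setC setCS sub next_level_dual.
Qed.

Definition itv A L U : pred {set T} :=
  fun S => [&& L \subset S, S \subset U & A #|S|].

End Sets.

(** Keeps only arithmetic facts, sparing [lia] the preprocessing of the set-theoretic context. *)
Ltac card_lia :=
  repeat match goal with
  | H : ?P |- _ =>
      lazymatch P with
      | is_true (leq _ _) => fail
      | is_true (leq _ _ && leq _ _) => fail
      | @eq nat _ _ => fail
      | _ => clear H
      end
  end; lia.

(** * Intervals of dimension four *)

Section Search.

Variables (X : eqType) (e : rel X).

(* Unlike [has], stops at the first witness under call by value. *)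
Fixpoint lazy_has (a : X -> bool) (s : seq X) :=
  if s is z :: s' then if a z then true else lazy_has a s' else false.

Lemma lazy_hasP a s : lazy_has a s -> exists2 z, z \in s & a z.
Proof.
elim: s => //= z s IH; case: ifP => [az _|_ /IH[w ws aw]].
  by exists z; rewrite ?mem_head.
by exists w; rewrite // inE ws orbT.
Qed.

Fixpoint span_search n c y rest :=
  if n is m.+1 then
    if c == y then nilp rest else
    lazy_has (fun z => if e c z then span_search m z y (rem z rest) else false)
      rest
  else false.

(** Here [n] is fuel, [c] the current vertex of the first path, and [rest] the unvisited vertices,
    including [v] but neither [x] nor [y]. The second path has at most [size rest + 2] vertices,
    whence its fuel. Targets are appended at the end so that they are tried last. *)
Fixpoint link_search n c v x y rest :=
  if n is m.+1 then
    if c == v then span_search (size rest).+2 x y (rcons rest y) else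
    lazy_has (fun z => if e c z then link_search m z v x y (rem z rest) else false)
      rest
  else false.

Lemma span_search_sound n c y rest : span_search n c y rest ->
  exists2 s, trail e c y s & perm_eq s (c :: rest).
Proof.
elim: n c rest => //= n IH c rest; case: eqP => [<- /nilP-> | _].
  by exists [:: c]; [apply: trail1 | apply: perm_refl].
case/lazy_hasP=> z zr; case: ifP => // ecz /IH[s zs ps].
exists ([:: c] ++ s); first exact: trail_cat (trail1 e c) ecz zs.
by rewrite /= perm_cons (permPl ps) perm_sym perm_to_rem.
Qed.

Arguments span_search : simpl never.

Lemma link_search_sound n c v x y rest : link_search n c v x y rest ->
  exists s t, [/\ trail e c v s, trail e x y t &
    perm_eq (s ++ t) (c :: x :: y :: rest)].
Proof.
elim: n c rest => //= n IH c rest; case: eqP => [<- /span_search_sound[t xt pt] | _].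
  exists [:: c], t; split=> //; first exact: trail1.
  by rewrite /= perm_cons (permPl pt) perm_cons perm_rcons.
case/lazy_hasP=> z zr; case: ifP => // ecz /IH[s [t [zs xt ps]]].
exists ([:: c] ++ s), t; split=> //; first exact: trail_cat (trail1 e c) ecz zs.
rewrite /= perm_cons (permPl ps); apply/permP => a.
by move/permP/(_ a): (perm_to_rem zr) => /= ->; 
  rewrite addnCA; congr (_ + _); rewrite addnCA.
Qed.

End Search.

Arguments link_search : simpl never.

(** * The rank-four Boolean lattice as bit words *)

Fixpoint bits n : seq bitseq :=
  if n is m.+1 then [seq false :: b | b <- bits m] ++ [seq true :: b | b <- bits m]
  else [:: [::]].

Lemma mem_bits n b : (b \in bits n) = (size b == n).
Proof.
elim: n b => [|n IH] [|x b] //=; rewrite ?inE //.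
  by rewrite mem_cat; apply/norP; split; apply/mapP => -[].
rewrite mem_cat eqSS -IH; apply/orP/idP => [[]/mapP[c cn [_ ->]] //|bn].
by case: x; [right | left]; apply/mapP; exists b.
Qed.

Lemma uniq_bits n : uniq (bits n).
Proof.
elim: n => //= n IH; have inj x : injective (cons x : bitseq -> bitseq) by move=> ? ? [].
rewrite cat_uniq !map_inj_uniq // IH andbT /=.
by apply/hasPn => _ /mapP[b _ ->]; apply/mapP => -[].
Qed.

Definition bits_cap (b c : bitseq) := [seq p.1 && p.2 | p <- zip b c].
Definition bits_sub (b c : bitseq) := all (fun p => p.1 ==> p.2) (zip b c).

(** Writing the size condition with a successor rules out equal words as well. Nested conditionals
    keep evaluation lazy. *)
Definition bits_adj (lev : bitseq) : rel bitseq := fun b c =>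
  let m := count id b in let n := count id c in
  if m == n then (count id (bits_cap b c)).+1 == m
  else if m < n then if bits_sub b c then next_level (nth false lev) m n else false
  else if bits_sub c b then next_level (nth false lev) n m else false.

Definition bits_in (lev b : bitseq) := (size b == 4) && nth false lev (count id b).

Definition bit k c := odd (iter k half c).

(** A coordinate is recorded by its membership pattern in the four ends, a number below 16.
    Nondecreasing lists give one representative per permutation of the coordinates. *)
Fixpoint sorted_columns n lo : seq (seq nat) :=
  if n is m.+1 then
    flatten [seq [seq c :: r | r <- sorted_columns m c] | c <- iota lo (16 - lo)]
  else [:: [::]].

Lemma mem_sorted_columns lo (s : seq nat) : path leq lo s -> all (ltn^~ 16) s ->
  s \in sorted_columns (size s) lo.
Proof.
elim: s lo => [|c s IH] lo //= /andP[loc cs] /andP[c16 s16].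
apply/flatten_mapP; exists c; first by rewrite mem_iota; lia.
by apply: map_f; apply: IH.
Qed.

(** The three comparisons normalize the ends up to reversing and exchanging the paths. The fuel 16
    is the number of words of length four. *)
Definition link_check (lev : bitseq) (V : seq bitseq) (u v x y : bitseq) :=
  let cu := count id u in let cx := count id x in
  if ~~ (cu <= cx) then true else if ~~ (cu <= count id v) then true
  else if ~~ (cx <= count id y) then true
  else if uniq [:: u; v; x; y] then
    if all (mem V) [:: u; v; x; y] then
      link_search (bits_adj lev) 16 u v x y
        (rcons [seq w <- V | w \notin [:: u; v; x; y]] v)
    else true
  else true.

Definition base_check :=
  all (fun lev =>
    if [|| nth false lev 1, nth false lev 2 | nth false lev 3] then
      let V := [seq b <- bits 4 | nth false lev (count id b)] in
      all (fun cs => link_check lev V (map (bit 3) cs) (map (bit 2) cs)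
                        (map (bit 1) cs) (map (bit 0) cs)) (sorted_columns 4 0)
    else true) (bits 5).

Lemma base_check_true : base_check.
Proof. by vm_compute. Qed.

Lemma link_check_sound lev u v x y :
  let V := [seq b <- bits 4 | nth false lev (count id b)] in
  link_check lev V u v x y -> uniq [:: u; v; x; y] ->
  bits_in lev u -> bits_in lev v -> bits_in lev x -> bits_in lev y ->
  count id u <= count id x -> count id u <= count id v ->
  count id x <= count id y ->
  linked (bits_adj lev) (bits_in lev) u v x y.
Proof.
move=> V; have VE b : (b \in V) = bits_in lev b.
  by rewrite mem_filter mem_bits andbC.
have unV : uniq V by rewrite filter_uniq ?uniq_bits.
clearbody V; move=> chk un Vu Vv Vx Vy ux uv xy; move: chk.
rewrite /link_check ux uv xy un /= !VE Vu Vv Vx Vy /=.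
set r := rcons _ _ => /link_search_sound[s [t [us xt st]]].
(* The two paths permute a duplicate-free list of the vertices, so multiplicities become
   membership. *)
exists s, t; split=> // w; rewrite -count_cat (permP st).
have unr : uniq (u :: x :: y :: r).
  rewrite /r /= !inE !mem_rcons rcons_uniq filter_uniq // !inE !mem_filter.
  by rewrite !inE !eqxx ?orbT /= !orbF andbT; clear -un; neq_solve.
rewrite count_uniq_mem // !inE /r mem_rcons inE mem_filter VE !inE !negb_or.
congr nat_of_bool.
case: (eqVneq w u) => [->|_]; rewrite ?Vu //=.
case: (eqVneq w x) => [->|_]; rewrite ?Vx //=.
case: (eqVneq w y) => [->|_]; rewrite ?Vy //=.
by case: (eqVneq w v) => [->|_]; rewrite ?Vv.
Qed.

(** * Transfer between bit words and sets *)

Section Base.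

Variable T : finType.
Variables (A : pred nat) (L U : {set T}) (ds : seq T).
Hypotheses (LU : L \subset U) (ds_uniq : uniq ds) (ds_size : size ds = 4).
Hypothesis ds_mem : ds =i U :\: L.

Definition encode (S : {set T}) : bitseq := [seq z \in S | z <- ds].
Definition decode (b : bitseq) : {set T} := L :|: [set z in mask b ds].
Definition levels : bitseq := [seq A c | c <- iota #|L| 5].

Lemma levels_nth k : k < 5 -> nth false levels k = A (#|L| + k).
Proof. by move=> k5; rewrite (nth_map 0) ?size_iota // nth_iota. Qed.

Let inLU (S : {set T}) := (L \subset S) && (S \subset U).

Lemma card_encode S : inLU S -> #|S| = #|L| + count id (encode S).
Proof.
case/andP=> LS SU; rewrite -(cardsID L S) (setIidPr LS); congr (_ + _).
rewrite count_map -size_filter -(card_uniqP _) ?filter_uniq //.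
rewrite -cardsE; apply: eq_card => z; rewrite inE mem_filter ds_mem !inE /=.
case: (boolP (z \in S)) => [zS|]; last by rewrite andbF.
by rewrite (subsetP SU) ?andbT.
Qed.

Lemma encode_cap S R : encode (S :&: R) = bits_cap (encode S) (encode R).
Proof.
rewrite /encode /bits_cap; elim: ds => //= z s ->; by rewrite inE.
Qed.

Lemma encode_sub S R : inLU S -> inLU R ->
  bits_sub (encode S) (encode R) = (S \subset R).
Proof.
case/andP=> LS SU /andP[LR RU].
have -> : bits_sub (encode S) (encode R) = all (fun z => (z \in S) ==> (z \in R)) ds.
  by rewrite /encode /bits_sub; elim: ds => //= z s ->.
apply/allP/subsetP => [sub z zS|sub z _]; last by apply/implyP; apply: sub.
case: (boolP (z \in L)) => zL; first exact: (subsetP LR).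
by apply: (implyP (sub z _)) => //; rewrite ds_mem inE zL (subsetP SU).
Qed.

Lemma count_encode S : count id (encode S) < 5.
Proof. by rewrite ltnS -ds_size -(size_map (mem S) ds) count_size. Qed.

Lemma bits_next m n : m < 5 -> n < 5 ->
  next_level (nth false levels) m n = next_level A (#|L| + m) (#|L| + n).
Proof.
move=> m5 n5; apply/next_levelP/next_levelP; rewrite !levels_nth // => -[Am An mn gap].
  split=> //; first by lia.
  move=> c mcn; have -> : c = #|L| + (c - #|L|) by lia.
  by rewrite -levels_nth; [apply: gap|]; lia.
split=> //; first by lia.
by move=> c mcn; rewrite levels_nth; [apply: gap|]; lia.
Qed.

Lemma encode_inj S R : inLU S -> inLU R -> encode S = encode R -> S = R.
Proof.
move=> iS iR E; apply/eqP; rewrite eqEsubset -!encode_sub // E.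
by rewrite /bits_sub; elim: (encode R) => //= -[].
Qed.

(** Paths found among words are carried to sets, so adjacency is transferred in this direction. *)
Lemma encode_adj S R : inLU S -> inLU R ->
  bits_adj levels (encode S) (encode R) -> adj A S R.
Proof.
move=> iS iR; rewrite /bits_adj /adj.
have iSR : inLU (S :&: R).
  case/andP: iS iR => LS SU /andP[LR RU]; rewrite /inLU subsetI LS LR.
  by rewrite subIset ?SU.
have cS := count_encode S; have cR := count_encode R.
rewrite !bits_next // -!card_encode // !encode_sub // -encode_cap.
case: eqP => [E /eqP cap|_]; last first.
  by case: ifP => _; case: ifP => // _ ->; rewrite ?orbT.
rewrite (card_encode iS) (card_encode iR) (card_encode iSR) -E -cap eqxx addnS /=.
have -> : S != R by apply: contra_eq_neq cap => ->; rewrite setIid; lia.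
by rewrite eqxx.
Qed.

Lemma encodeK S : inLU S -> decode (encode S) = S.
Proof.
case/andP=> LS SU; rewrite /decode /encode -filter_mask.
apply/setP => z; rewrite !inE mem_filter ds_mem !inE /=.
case: (boolP (z \in L)) => [/(subsetP LS)->//|_] /=.
by case: (boolP (z \in S)) => //= /(subsetP SU)->.
Qed.

Lemma decodeK b : size b = 4 -> encode (decode b) = b.
Proof.
move=> sb; apply: (@eq_from_nth _ false); rewrite size_map ds_size // => k k4.
have [z0 _] : exists z0, z0 \in ds.
  by case: (ds) ds_size => // z0 s _; exists z0; rewrite mem_head.
rewrite (nth_map z0) ?ds_size // !inE in_mask // mem_nth ?ds_size //=.
have : nth z0 ds k \in ds by rewrite mem_nth ?ds_size.
by rewrite ds_mem inE index_uniq ?ds_size // => /andP[/negPf-> _].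
Qed.

Lemma decode_inLU b : inLU (decode b).
Proof.
rewrite /inLU subsetUl subUset LU; apply/subsetP => z; rewrite inE => /mem_mask.
by rewrite ds_mem => /setDP[].
Qed.

Lemma encode_in S : itv A L U S -> bits_in levels (encode S).
Proof.
case/and3P=> LS SU AS; have iS : inLU S by rewrite /inLU LS.
by rewrite /bits_in size_map ds_size eqxx levels_nth ?count_encode // -card_encode.
Qed.

Lemma decode_in b : bits_in levels b -> itv A L U (decode b).
Proof.
case/andP=> /eqP sb; rewrite -{1}(decodeK sb) levels_nth ?count_encode //.
rewrite -card_encode ?decode_inLU // => Ab.
by case/andP: (decode_inLU b) => *; apply/and3P.
Qed.

Lemma linked_decode u v x y :
  linked (bits_adj levels) (bits_in levels)
    (encode u) (encode v) (encode x) (encode y) ->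
  itv A L U u -> itv A L U v -> itv A L U x -> itv A L U y ->
  linked (adj A) (itv A L U) u v x y.
Proof.
have dK S : itv A L U S -> decode (encode S) = S.
  by case/and3P=> LS SU _; apply: encodeK; rewrite /inLU LS.
move=> lk /dK<- /dK<- /dK<- /dK<-.
apply: (@linked_map bitseq {set T} _ _ _ _ decode encode) lk.
- by move=> b Vb; rewrite decode_in // decodeK //; case/andP: Vb => /eqP.
- by move=> S VS; rewrite encode_in // dK.
- move=> b c /andP[/eqP sb _] /andP[/eqP sc _]; rewrite -{1}(decodeK sb) -{1}(decodeK sc).
  by apply: encode_adj; apply: decode_inLU.
Qed.

End Base.

(** The membership pattern of [z] as a four-bit number; [bit 3] down to [bit 0] recover [u], [v],
    [x], [y]. *)
Definition column (T : finType) (u v x y : {set T}) z :=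
  8 * (z \in u) + 4 * (z \in v) + 2 * (z \in x) + (z \in y).

(* The symmetric group of [U :\: L] acts on the configuration, hence the free
   coordinates may be listed in the order of their membership patterns in the
   four end sets. *)
Lemma itv_linkable4 (T : finType) (A : pred nat) (L U : {set T}) :
  L \subset U -> #|U| = #|L| + 4 -> (exists2 a, A a & #|L| < a < #|U|) ->
  linkable (adj A) (itv A L U).
Proof.
move=> LU cU [a Aa la].
have main u v x y : itv A L U u -> itv A L U v -> itv A L U x -> itv A L U y ->
    uniq [:: u; v; x; y] -> #|u| <= #|x| -> #|u| <= #|v| -> #|x| <= #|y| ->
    linked (adj A) (itv A L U) u v x y.
  move=> Vu Vv Vx Vy un ux uv xy.
  pose key := column u v x y.
  pose ds := sort (relpre key leq) (enum (U :\: L)).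
  have ds_uniq : uniq ds by rewrite sort_uniq enum_uniq.
  have ds_size : size ds = 4.
    by rewrite size_sort -cardE cardsD (setIidPr LU) cU addKn.
  have ds_mem : ds =i U :\: L by move=> z; rewrite mem_sort mem_enum.
  apply: (linked_decode LU ds_uniq ds_size ds_mem) => //.
  set lev := levels A L.
  have inn S : itv A L U S -> (L \subset S) && (S \subset U).
    by case/and3P=> -> ->.
  have cE S : itv A L U S -> count id (encode ds S) = #|S| - #|L|.
    by move=> VS; rewrite (card_encode ds_uniq ds_mem (inn S VS)) addKn.
  apply: link_check_sound; rewrite ?cE ?leq_sub2r //; try exact: encode_in.
    have cs_in : map key ds \in sorted_columns 4 0.
      rewrite -ds_size -(size_map key); apply: mem_sorted_columns.
        have : sorted leq (map key ds).
          by rewrite sorted_map; apply: sort_sorted => z w; apply: leq_total.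
        by case: (map key ds).
      apply/allP => _ /mapP[z _ ->]; rewrite /key /column.
      by case: (_ \in _); case: (_ \in _); case: (_ \in _); case: (_ \in _).
    have := allP base_check_true lev; rewrite mem_bits size_map size_iota eqxx.
    move=> /(_ isT); rewrite ifT; last first.
      have : nth false lev (a - #|L|) by rewrite levels_nth ?subnKC //; card_lia.
      have : 0 < a - #|L| < 4 by card_lia.
      by case: (a - #|L|) => [|[|[|[|k]]]] //= _ ->; rewrite ?orbT.
    move/allP/(_ _ cs_in); rewrite -!map_comp.
    have eqm k (S : {set T}) : (forall z, bit k (key z) = (z \in S)) ->
        map (bit k \o key) ds = encode ds S.
      by move=> E; apply: eq_map => z; rewrite /= E.
    rewrite (eqm 3 u) ?(eqm 2 v) ?(eqm 1 x) ?(eqm 0 y) //;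
      move=> z; rewrite /key /column;
      by case: (_ \in u); case: (_ \in v); case: (_ \in x); case: (_ \in y).
  rewrite -[[:: _; _; _; _]]/(map (encode ds) [:: u; v; x; y]).
  rewrite map_inj_in_uniq // => S R; rewrite !inE => Sin Rin.
  by apply: (encode_inj ds_mem); apply: inn;
    [case/or4P: Sin | case/or4P: Rin] => /eqP->.
(* Exchanging the paths puts the smallest end in the first pair; reversing each path then orders its
   ends. Minima are compared because reversal leaves them unchanged. *)
move=> u v x y; wlog ux : u v x y / minn #|u| #|v| <= minn #|x| #|y| => [wl|].
  case: (leqP (minn #|u| #|v|) (minn #|x| #|y|)) => [|/ltnW] le Vu Vv Vx Vy un.
    exact: wl.
  by apply: linkedC; apply: wl => //; clear -un; neq_solve.
move=> Vu Vv Vx Vy un.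
wlog uv : u v un Vu Vv ux / #|u| <= #|v| => [wl|].
  case: (leqP #|u| #|v|) => [|/ltnW] le; first exact: wl.
  apply: linked_rev; first exact: adj_sym.
  by apply: wl => //; [clear -un; neq_solve | rewrite minnC].
wlog xy : x y un Vx Vy ux / #|x| <= #|y| => [wl|].
  case: (leqP #|x| #|y|) => [|/ltnW] le; first exact: wl.
  apply: linkedC; apply: linked_rev; first exact: adj_sym.
  apply: linkedC.
  by apply: wl => //; [clear -un; neq_solve | rewrite (minnC #|y|)].
by apply: main => //; move: ux; rewrite (minn_idPl uv) (minn_idPl xy).
Qed.

(** * Edges between the two halves *)

(** Let [Y] be the set of forbidden points. A choice fails only if both sets have the same single
    point [p] outside [Y]; by size both then equal [p |: Y]. *)
Lemma distinct_in_two_sets (X : finType) (N M : {set X}) (v y : X) :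
  3 <= #|N| -> 3 <= #|M| -> N != M ->
  exists p q, [/\ p \in N, q \in M, p != q, p \notin [:: v; y]
    & q \notin [:: v; y]].
Proof.
move=> cN cM NM; pose Y := [set v; y].
have Yin p : (p \notin [:: v; y]) = (p \notin Y) by rewrite !inE.
have cY : #|Y| <= 2 by rewrite cards2; case: eqP.
have ex (N' : {set X}) : 3 <= #|N'| -> exists2 p, p \in N' & p \notin Y.
  move=> cN'; apply/subsetPn; apply: contraL (cN') => /subset_leq_card le.
  by rewrite -ltnNge ltnS (leq_trans le).
have [[p pN pY] [q qM qY]] := (ex N cN, ex M cM).
case: (eqVneq p q) => [pq|pq]; last by exists p, q; rewrite !Yin.
subst q.
have cpY : #|p |: Y| <= 3 by rewrite cardsU1 pY; lia.
have eqpY (N' : {set X}) : 3 <= #|N'| -> N' \subset p |: Y -> N' = p |: Y.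
  by move=> cN' sub; apply/eqP; rewrite eqEcard sub (leq_trans cpY).
case: (boolP (N \subset p |: Y)) => [NpY|/subsetPn[p' p'N]]; last first.
  by rewrite in_setU1 => /norP[p'p ?]; exists p', p; rewrite !Yin; split.
case: (boolP (M \subset p |: Y)) => [MpY|/subsetPn[p' p'N]]; last first.
  by rewrite in_setU1 => /norP[p'p ?]; exists p, p'; rewrite !Yin eq_sym; split.
by move: NM; rewrite (eqpY N) // (eqpY M) // eqxx.
Qed.

Section Cross.

Variable T : finType.
Implicit Types (L U S R P Q B C : {set T}) (A : pred nat) (i j k : T).

Lemma next_level_ext A A' m a b : (forall c, c <= m -> A c -> A' c) ->
  (forall c, c <= m -> A' c -> A c) ->
  a <= m -> b <= m -> next_level A a b -> next_level A' a b.
Proof.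
move=> AA' A'A am bm /next_levelP[Aa Ab ab gap]; apply/next_levelP.
split=> //; try exact: AA'.
by move=> c acb; apply: contraNN (gap c acb); apply: A'A; lia.
Qed.

(** The double dual agrees with [A] up to level [#|T|], which is all that [next_level_ext] asks
    for. *)
Lemma adj_dual A S R : adj (dual T A) (~: S) (~: R) = adj A S R.
Proof.
apply/idP/idP; last exact: adj_setC.
move/adj_setC; rewrite !setCK.
have ext a b : a <= #|T| -> b <= #|T| ->
    next_level (dual T (dual T A)) a b -> next_level A a b.
  by apply: next_level_ext => c cT; rewrite /dual subKn.
by case/or3P=> [same|/andP[lev ?]|/andP[lev ?]]; apply/or3P;
  [constructor 1 | constructor 2 | constructor 3];
  rewrite // ext ?max_card.
Qed.

Lemma itv_dual A L U S : itv (dual T A) (~: U) (~: L) (~: S) = itv A L U S.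
Proof.
rewrite /itv !setCS /dual card_setC subKn ?max_card //.
by rewrite andbCA.
Qed.

(* [A] has levels strictly inside both of the intervals [L, U :\ i] and
   [i |: L, U]. *)
Definition splittable A L U :=
  (exists2 a, A a & #|L|.+2 <= a <= #|U| - 2) \/ (A #|L|.+1 /\ A #|U|.-1).

Section Half.

Variables (A : pred nat) (L U : {set T}) (i : T).
Hypotheses (LU : L \subset U) (iU : i \in U) (iL : i \notin L).
Hypotheses (dim : #|L| + 5 <= #|U|) (sp : splittable A L U).

Local Notation V0 := (itv A L (U :\ i)).
Local Notation V1 := (itv A (i |: L) U).

Lemma insert_bottom_sub : i |: L \subset U.
Proof. by rewrite subUset sub1set iU. Qed.

Lemma card_insert_bottom : #|i |: L| = #|L|.+1.
Proof. by rewrite cardsU1 iL. Qed.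

Lemma card_delete_top : #|U :\ i| = #|U|.-1.
Proof. by rewrite [#|U|](cardsD1 i) iU. Qed.

Lemma bottom_sub_delete : L \subset U :\ i.
Proof. by rewrite subsetD1 LU. Qed.

Lemma notin_lower S : V0 S -> i \notin S.
Proof. by case/and3P=> _; rewrite subsetD1 => /andP[]. Qed.

Lemma swap_upper S j : V0 S -> j \in S :\: L -> V1 (i |: S :\ j).
Proof.
move=> VS; have iS := notin_lower VS; case/and3P: VS => LS SU AS.
rewrite inE => /andP[jL jS]; apply/and3P; split.
- by apply: setUS; rewrite subsetD1 LS.
- rewrite subUset sub1set iU (subset_trans (subsetDl _ _)) //.
  by apply: subset_trans SU _; apply: subsetDl.
- by rewrite cardsU1 !inE (negPf iS) andbF /=; rewrite (cardsD1 j S) jS in AS.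
Qed.

Lemma upper_neighbour S b : V0 S -> next_level A #|S| b -> b <= #|U| ->
  exists R, [/\ V1 R, adj A S R & i |: S \subset R].
Proof.
move=> VS lev bU; have iS := notin_lower VS; case/and3P: VS => LS SU AS.
case/next_levelP: (lev) => _ Ab Sb _.
have iSU : i |: S \subset U.
  by rewrite subUset sub1set iU (subset_trans SU) ?subsetDl.
have [|R [iSR RU cR]] := between_exists iSU (a := b).
  by rewrite cardsU1 iS bU andbT.
exists R; split=> //.
- by apply/and3P; rewrite cR; split=> //; apply: subset_trans iSR; apply: setUS.
- by apply: adj_up; rewrite ?cR //; apply: subset_trans iSR; apply: subsetUr.
Qed.

(** Two elements of [S :\: L] give two swaps with [i]. If [j] is the only one, the swap is paired
    with a neighbour on the next level above, which still contains [j]. *)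
Lemma two_neighbours S : V0 S -> S != L -> exists P Q,
  [/\ V1 P, V1 Q, P != Q, adj A S P & adj A S Q].
Proof.
move=> VS SL; have iS := notin_lower VS; case/and3P: (VS) => LS SU AS.
have /set0Pn[j jSL] : S :\: L != set0.
  by rewrite setD_eq0; apply: contra SL => sub; rewrite eqEsubset sub.
have jS : j \in S by case/setDP: jSL.
have ij : j != i by apply: contraNneq iS => <-.
case: (boolP (S :\: L == [set j])) => [/eqP SLj|].
  have cS : #|S| = #|L|.+1.
    by rewrite -(cardsID L S) (setIidPr LS) SLj cards1 addn1.
  have [c Ac lc] : exists2 c, A c & #|S| < c <= #|U|.
    by case: sp => [[c Ac lc]|[_ Ac]];
      [exists c | exists #|U|.-1]; rewrite ?cS //; card_lia.
  have [b lev bc] := next_level_exists AS Ac (proj1 (andP lc)).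
  have [|R [VR SR iSR]] := upper_neighbour VS lev; first by card_lia.
  exists (i |: S :\ j), R; split=> //; [exact: swap_upper | | exact: adj_swap].
  apply: contraTneq (subsetP iSR j _) => [<-|]; last by rewrite inE jS orbT.
  by rewrite !inE (negPf ij) eqxx.
move=> SLj; have [k kSL kj] : exists2 k, k \in S :\: L & k != j.
  have /subsetPn[k ? kj] : ~~ (S :\: L \subset [set j]).
    by apply: contra SLj => sub; rewrite eqEsubset sub sub1set.
  by exists k; rewrite // inE in kj.
have kS : k \in S by case/setDP: kSL.
exists (i |: S :\ j), (i |: S :\ k); split; try exact: swap_upper; try exact: adj_swap.
have ki : k != i by apply: contraNneq iS => <-.
apply: contraTneq (_ : k \in i |: S :\ j) => [->|].
  by rewrite !inE (negPf ki) eqxx.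
by rewrite !inE kj kS orbT.
Qed.

Lemma neighbour S : V0 S -> exists2 R, V1 R & adj A S R.
Proof.
move=> VS; case: (eqVneq S L) => [SL|/(two_neighbours VS)[P [_ [VP _ _ SP _]]]].
  have AS : A #|S| by case/and3P: VS.
  have [c Ac lc] : exists2 c, A c & #|S| < c <= #|U|.
    by rewrite SL; case: sp => [[c Ac lc]|[_ Ac]];
      [exists c | exists #|U|.-1] => //; card_lia.
  have [b lev bc] := next_level_exists AS Ac (proj1 (andP lc)).
  have [|R [VR SR _]] := upper_neighbour VS lev; first by card_lia.
  by exists R.
by exists P.
Qed.

(** At most one of two distinct vertices is [L]; the other has two neighbours across and can avoid
    the one chosen for its partner. *)
Lemma distinct_ends_lower : distinct_ends (adj A) V0 V1.
Proof.
have half S R : V0 S -> V0 R -> S != L ->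
    exists S' R', [/\ V1 S', V1 R', S' != R', adj A S S' & adj A R R'].
  move=> VS VR SL; have [P [Q [VP VQ PQ SP SQ]]] := two_neighbours VS SL.
  have [R' VR' RR'] := neighbour VR.
  case: (eqVneq P R') => [PR|PR]; last by exists P, R'.
  by exists Q, R'; split; rewrite // -PR eq_sym.
move=> S R VS VR SR; case: (eqVneq S L) => [SL|]; last exact: half.
have [|R' [S' [? ? ? ? ?]]] := half R S VR VS; first by rewrite -SL eq_sym.
by exists S', R'; split; rewrite // eq_sym.
Qed.

Lemma lower_level : exists a, [/\ A a, #|L| < a & a < #|U :\ i|].
Proof.
rewrite card_delete_top; case: sp => [[a Aa la]|[Aa _]]; [exists a | exists #|L|.+1];
  by split=> //; card_lia.
Qed.

(** A vertex on an inner level of the lower half, away from the three ends, has two neighbours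
    across, one of them not [y]. *)
Lemma exit_avoiding_lower : exit_avoiding (adj A) V0 V1.
Proof.
move=> u v x y _ _ _ _; have [a [Aa la aU]] := lower_level.
have dimUi : #|L| + 4 <= #|U :\ i| by rewrite card_delete_top; card_lia.
have la' : #|L| < a < #|U :\ i| by rewrite la.
have [//|z [Lz zU cz zn]] := level_avoiding (r := [:: u; v; x]) bottom_sub_delete la' dimUi.
have Vz : V0 z by apply/and3P; rewrite cz.
have zL : z != L by apply: contraTneq la => <-; rewrite cz ltnn.
have [P [Q [VP VQ PQ zP zQ]]] := two_neighbours Vz zL.
case: (eqVneq P y) => [Py|Py]; last by exists z, P.
by exists z, Q; split=> //; rewrite -Py eq_sym.
Qed.

Definition uppers S := [set R | V1 R && adj A S R].

Lemma two_exits_level a : A a -> #|L| < a < #|U|.-1 ->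
  (forall S, V0 S -> #|S| = a -> 3 <= #|uppers S|) ->
  (forall S R, V0 S -> V0 R -> #|S| = a -> #|R| = a -> S != R ->
    uppers S != uppers R) ->
  two_exits (adj A) V0 V1.
Proof.
move=> Aa la deg3 inj u x v y _ _ _ _.
have dimUi : #|L| + 4 <= #|U :\ i| by rewrite card_delete_top; card_lia.
have la' : #|L| < a < #|U :\ i| by rewrite card_delete_top.
have [//|z [Lz zU cz zn]] := level_avoiding (r := [:: u; x]) bottom_sub_delete la' dimUi.
have [//|w [Lw wU cw wn]] := level_avoiding (r := [:: z; u; x]) bottom_sub_delete la' dimUi.
have Vz : V0 z by apply/and3P; rewrite cz.
have Vw : V0 w by apply/and3P; rewrite cw.
have zw : z != w by clear -wn; neq_solve.
have [z' [w' [z'N w'N zw' z'n w'n]]] :=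
  distinct_in_two_sets v y (deg3 z Vz cz) (deg3 w Vw cw) (inj z w Vz Vw cz cw zw).
move: z'N w'N; rewrite !inE => /andP[Vz' zz'] /andP[Vw' ww'].
exists z, w, z', w'; split=> // neq.
  by clear -neq zn wn; neq_solve.
by clear -neq zw' z'n w'n; neq_solve.
Qed.

(** Swapping [i] for an element of [S :\: L] gives at least three neighbours, since [S] has at least
    three elements outside [L]. *)
Lemma two_exits_mid a : A a -> #|L| + 3 <= a <= #|U| - 2 ->
  two_exits (adj A) V0 V1.
Proof.
move=> Aa la; apply: (two_exits_level Aa); first by card_lia.
- move=> S VS cS; have iS := notin_lower VS; case/and3P: (VS) => LS SU AS.
  have sub : [set i |: S :\ j | j in S :\: L] \subset uppers S.
    apply/subsetP => _ /imsetP[j jSL ->]; rewrite inE swap_upper //.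
    by rewrite adj_swap //; case/setDP: jSL.
  apply: leq_trans (subset_leq_card sub); rewrite card_in_imset.
    by rewrite cardsD (setIidPr LS) cS; card_lia.
  move=> j k jSL kSL /setP/(_ j); rewrite !inE eqxx /=.
  have [jS _] := setDP jSL; rewrite jS andbT (negPf (_ : j != i)).
    by case: eqP.
  by apply: contraNneq iS => <-.
- move=> S R VS VR cS cR SR; have iS := notin_lower VS.
  have iR := notin_lower VR; case/and3P: (VS) (VR) => LS SU AS /and3P[LR RU AR].
  (* To separate the neighbourhoods, swap out of [S] some [k] other than an element [j] missing from
     [R]. The result [Q] meets [R] in at most [a - 2] elements, so it is not adjacent to [R]. *)
  have /subsetPn[j jS jR] : ~~ (S \subset R).
    by apply: contra SR => sub; rewrite eqEcard sub cS cR leqnn.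
  have jL : j \notin L by apply: contra jR; apply: (subsetP LR).
  have [k kSL kj] : exists2 k, k \in S :\: L & k != j.
    have /subsetPn[k ? kj] : ~~ (S :\: L \subset [set j]).
      apply/negP => /subset_leq_card; rewrite cards1 cardsD (setIidPr LS) cS; card_lia.
    by exists k; rewrite // inE in kj.
  have [kS kL] := setDP kSL.
  have VQ := swap_upper VS kSL; have SQ := adj_swap A iS kS.
  set Q := i |: S :\ k in VQ SQ.
  apply: contraTneq (_ : Q \in uppers S) => [->|]; last by rewrite inE VQ.
  have cQ : #|Q| = a.
    by rewrite cardsU1 !inE (negPf iS) andbF -cS (cardsD1 k S) kS.
  rewrite inE VQ /= /adj /next_level cR cQ ltnn !andbF !orbF eqxx /=.
  rewrite negb_and; apply/orP; left.
  have sub : R :&: Q \subset (S :\ k) :\ j.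
    apply/subsetP => b; rewrite !inE => /andP[bR].
    case: (eqVneq b i) => [bi|_]; first by rewrite -bi bR in iR.
    by move=> /= ->; rewrite andbT; apply: contraNneq jR => <-.
  have := subset_leq_card sub.
  have cSk : #|S| = #|S :\ k|.+1 by rewrite (cardsD1 k S) kS.
  have cSkj : #|S :\ k| = #|S :\ k :\ j|.+1.
    by rewrite (cardsD1 j (S :\ k)) !inE eq_sym kj jS.
  by move=> le; apply/eqP; card_lia.
Qed.

(** The two extreme inner levels are consecutive in [A], so [S] on the lower one is joined to
    [U :\ k] for each [k] outside [i |: S]. An element of [R] missing from [S] tells their
    neighbourhoods apart. *)
Lemma two_exits_extreme : A #|L|.+1 -> A #|U|.-1 ->
  (forall a, A a -> ~~ (#|L|.+2 <= a <= #|U| - 2)) ->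
  two_exits (adj A) V0 V1.
Proof.
move=> Al Au gap.
have lev : next_level A #|L|.+1 #|U|.-1.
  apply/next_levelP; split=> //; first by card_lia.
  by move=> c lc; apply/negP => /gap; card_lia.
have up S k : V0 S -> #|S| = #|L|.+1 -> k \in U :\: (i |: S) ->
    U :\ k \in uppers S.
  move=> VS cS; have iS := notin_lower VS; case/and3P: (VS) => LS SU AS.
  rewrite !inE negb_or => /andP[/andP[ki kS] kU].
  have SUk : S \subset U :\ k.
    by rewrite subsetD1 kS andbT (subset_trans SU) ?subsetDl.
  have cUk : #|U :\ k| = #|U|.-1 by rewrite (cardsD1 k U) kU.
  rewrite adj_up ?cUk ?cS // andbT; apply/and3P; rewrite cUk; split=> //.
    rewrite subUset sub1set !inE eq_sym ki iU /=; exact: subset_trans SUk.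
  exact: subsetDl.
apply: (two_exits_level Al); first by card_lia.
- move=> S VS cS; have iS := notin_lower VS; case/and3P: (VS) => LS SU AS.
  have sub : [set U :\ k | k in U :\: (i |: S)] \subset uppers S.
    by apply/subsetP => _ /imsetP[k kU ->]; apply: up.
  apply: leq_trans (subset_leq_card sub); rewrite card_in_imset.
    have iSU : i |: S \subset U.
      by rewrite subUset sub1set iU (subset_trans SU) ?subsetDl.
    by rewrite cardsD (setIidPr iSU) cardsU1 iS cS; card_lia.
  move=> j k /setDP[jU _] /setDP[kU _] /setP/(_ j); rewrite !inE eqxx jU andbT.
  by case: eqP.
- move=> S R VS VR cS cR SR; have iR := notin_lower VR.
  case/and3P: (VS) (VR) => LS SU AS /and3P[LR RU AR].
  have /subsetPn[k kR kS] : ~~ (R \subset S).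
    by apply: contra SR => sub; rewrite eq_sym eqEcard sub cS cR leqnn.
  have kU : k \in U by apply: (subsetP (subset_trans RU (subsetDl _ _))).
  have ki : k != i by apply: contraNneq iR => <-.
  apply: contraTneq (up S k VS cS _) => [->|]; last first.
    by rewrite !inE negb_or ki kS.
  have cUk : #|U :\ k| = #|U|.-1 by rewrite (cardsD1 k U) kU.
  rewrite inE negb_and; apply/orP; right.
  have Rk : ~~ (R \subset U :\ k) by rewrite subsetD1 kR andbF.
  rewrite /adj cUk cR (negPf Rk) andbF /=.
  rewrite (_ : _ == _ = false); last by apply/eqP; card_lia.
  by apply/negP => /andP[/next_levelP[_ _ ? _] _]; card_lia.
Qed.

End Half.
End Cross.

(** * Transport of the crossing conditions along an involution *)

Section Conjugate.

Variables (X : eqType) (e e' : rel X) (f : X -> X) (V0 V1 V0' V1' : pred X).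
Hypotheses (fK : involutive f) (fe : forall x y, e' (f x) (f y) = e x y).
Hypotheses (fV0 : forall x, V0' (f x) = V0 x).
Hypotheses (fV1 : forall x, V1' (f x) = V1 x).

Let f_inj := can_inj fK.

Lemma distinct_ends_conj : distinct_ends e' V0' V1' -> distinct_ends e V0 V1.
Proof.
move=> de s t; rewrite -!fV0 -(inj_eq f_inj) => Vs Vt /(de _ _ Vs Vt).
case=> s' [t' [Vs' Vt' st' ss' tt']]; exists (f s'), (f t').
by rewrite -!fV1 (inj_eq f_inj) -!fe !fK.
Qed.

Lemma exit_avoiding_conj : exit_avoiding e' V0' V1' -> exit_avoiding e V0 V1.
Proof.
move=> ea u v x y; rewrite -!fV0 -fV1 => Vu Vv Vx Vy.
have [z [z' [Vz Vz' zn zy zz']]] := ea _ _ _ _ Vu Vv Vx Vy.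
exists (f z), (f z'); rewrite -fV0 -fV1 -fe !fK; split=> //.
  by move: zn; rewrite !inE !(can2_eq fK fK).
by rewrite (can2_eq fK fK).
Qed.

Lemma two_exits_conj : two_exits e' V0' V1' -> two_exits e V0 V1.
Proof.
move=> te u x v y; rewrite -!fV0 -!fV1 => Vu Vx Vv Vy.
have [z [w [z' [w' [[Vz Vw Vz' Vw'] n0 n1 zz' ww']]]]] := te _ _ _ _ Vu Vx Vv Vy.
exists (f z), (f w), (f z'), (f w'); rewrite -!fV0 -!fV1 -!fe !fK.
rewrite !(inj_eq f_inj) in n0 n1.
split=> // [/n0|/n1]; rewrite -[in X in _ -> X](map_inj_uniq f_inj) /=;
  by rewrite !fK.
Qed.

End Conjugate.

Lemma two_exits_sym (X : eqType) (e : rel X) V0 V1 : symmetric e ->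
  two_exits e V1 V0 -> two_exits e V0 V1.
Proof.
move=> es te u x v y Vu Vx Vv Vy.
have [z [w [z' [w' [[Vz Vw Vz' Vw'] n0 n1 zz' ww']]]]] := te _ _ _ _ Vv Vy Vu Vx.
by exists z', w', z, w; split=> //; rewrite es.
Qed.

(** * The induction *)

Section Step.

Variable T : finType.
Implicit Types (L U S R : {set T}) (A : pred nat) (i : T).

Lemma itv_split A L U i : i \in U -> i \notin L -> forall S,
  nat_of_bool (itv A L U S) = itv A L (U :\ i) S + itv A (i |: L) U S.
Proof.
move=> iU iL S; rewrite /itv subsetD1 subUset sub1set.
by case: (i \in S); rewrite ?andbF ?andbT /= ?addn0.
Qed.

Lemma setC_lower U i : ~: (U :\ i) = i |: ~: U.
Proof. by apply/setP => x; rewrite !inE negb_and negbK. Qed.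

Lemma setC_upper L i : ~: (i |: L) = ~: L :\ i.
Proof. by apply/setP => x; rewrite !inE negb_or. Qed.

Lemma splittable_dual A L U : #|L| + 5 <= #|U| ->
  splittable A L U -> splittable (dual T A) (~: U) (~: L).
Proof.
rewrite /splittable /dual !card_setC; have := max_card (mem U).
move: #|U| #|L| #|T| => h l n hn dim [[a Aa la]|[Al Au]]; [left|right].
  by exists (n - a); [rewrite subKn //|]; lia.
have -> : n - (n - h).+1 = h.-1 by lia.
by have -> : n - (n - l).-1 = l.+1 by lia.
Qed.

Lemma itv_spannable A L U : L \subset U -> #|L| + 4 <= #|U| ->
  (exists2 a, A a & #|L| < a < #|U|) ->
  linkable (adj A) (itv A L U) -> spannable (adj A) (itv A L U).
Proof.
move=> LU dim [a Aa la]; apply: linkable_spannable; first exact: adj_sym.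
move=> u v.
have [//|x [Lx xU cx xn]] := level_avoiding (r := [:: u; v]) LU la dim.
have [//|y [Ly yU cy yn]] := level_avoiding (r := [:: u; v; x]) LU la dim.
exists x, y; rewrite /itv Lx xU Ly yU cx cy Aa; split=> // uv.
by clear -uv xn yn; neq_solve.
Qed.

Lemma itv_linkable_split A L U i : L \subset U -> i \in U -> i \notin L ->
  #|L| + 5 <= #|U| -> splittable A L U ->
  linkable (adj A) (itv A L (U :\ i)) -> linkable (adj A) (itv A (i |: L) U) ->
  linkable (adj A) (itv A L U).
Proof.
move=> LU iU iL dim sp l0 l1.
have UT : #|U| <= #|T| by apply: max_card.
have LU' : ~: U \subset ~: L by rewrite setCS.
have iU' : i \in ~: L by rewrite inE.
have iL' : i \notin ~: U by rewrite inE negbK.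
have dim' : #|~: U| + 5 <= #|~: L|.
  rewrite !card_setC; have := max_card (mem U); move: dim; clear.
  by move: #|U| #|L| #|T| => h l n; lia.
have sp' := splittable_dual dim sp.
have d0 S : itv (dual T A) (~: U) (~: L :\ i) (~: S) = itv A (i |: L) U S.
  by rewrite -setC_upper itv_dual.
have d1 S : itv (dual T A) (i |: ~: U) (~: L) (~: S) = itv A L (U :\ i) S.
  by rewrite -setC_lower itv_dual.
have cUi := card_delete_top iU; have ciL := card_insert_bottom iL.
apply: (linkable_join (adj_sym A) (itv_split A iU iL) l0 l1).
- apply: itv_spannable l0; [exact: bottom_sub_delete | by rewrite cUi; card_lia | rewrite cUi].
  by case: sp => [[a Aa la]|[Aa _]]; [exists a | exists #|L|.+1] => //; card_lia.
- apply: itv_spannable l1; [exact: insert_bottom_sub | by rewrite ciL; card_lia | rewrite ciL].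
  by case: sp => [[a Aa la]|[_ Aa]]; [exists a | exists #|U|.-1] => //; card_lia.
- exact: distinct_ends_lower.
- apply: (distinct_ends_conj (@setCK _) (@adj_dual _ A) d0 d1).
  exact: distinct_ends_lower.
- exact: exit_avoiding_lower.
- apply: (exit_avoiding_conj (@setCK _) (@adj_dual _ A) d0 d1).
  exact: exit_avoiding_lower.
(* The list covers the levels from [#|L| + 2] to [#|U| - 2]. The lowest of them is too low for
   [two_exits_mid], but its dual qualifies because the dimension is at least 5. *)
- case: (boolP (has A (iota #|L|.+2 (#|U| - #|L| - 3)))) => [/hasP[a]|/hasPn no].
    rewrite mem_iota => la Aa; case: (leqP (#|L| + 3) a) => la3.
      by apply: (two_exits_mid _ _ _ _ Aa) => //; card_lia.
    apply: two_exits_sym (adj_sym A) _.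
    apply: (two_exits_conj (@setCK _) (@adj_dual _ A) d0 d1).
    apply: (@two_exits_mid _ _ _ _ _ _ _ _ _ (#|T| - a)) => //.
      by rewrite /dual subKn //; card_lia.
    by rewrite !card_setC; card_lia.
  case: sp => [[a Aa la]|[Al Au]].
    by have := no a; rewrite mem_iota Aa => /(_ _)/negP[]//; card_lia.
  apply: two_exits_extreme => // a Aa; apply/negP => la.
  by have := no a; rewrite mem_iota Aa => /(_ _)/negP[]//; card_lia.
Qed.

(** The upper half has at most the vertices [i |: L] and [U]. The first is adjacent to the whole
    lower half, the second to everything except possibly [L], so each is inserted by
    [linkable_insert]. *)
Lemma itv_linkable_low A L U i : L \subset U -> i \in U -> i \notin L ->
  #|L| + 5 <= #|U| -> A #|L|.+1 ->
  (forall a, A a -> #|L| < a < #|U| -> a = #|L|.+1) ->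
  linkable (adj A) (itv A L (U :\ i)) -> linkable (adj A) (itv A L U).
Proof.
move=> LU iU iL dim Al only lk.
have cUi := card_delete_top iU; have ciL := card_insert_bottom iL; have LUi' := bottom_sub_delete LU iL.
have dimUi : #|L| + 4 <= #|U :\ i| by rewrite cUi; card_lia.
have la : #|L| < #|L|.+1 < #|U :\ i| by rewrite cUi; card_lia.
have iLU' := insert_bottom_sub LU iU.
pose W := predU (itv A L (U :\ i)) (pred1 (i |: L)).
have iLn : ~~ itv A L (U :\ i) (i |: L).
  by rewrite /itv subsetD1 setU11 !andbF.
have Wsum S : nat_of_bool (W S) = itv A L (U :\ i) S + (S == i |: L).
  by rewrite /W /=; case: eqP => [->|]; rewrite ?(negPf iLn) ?orbT ?orbF ?addn0.
have cards S : itv A L (U :\ i) S -> S = L \/ #|S| = #|L|.+1.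
  case/and3P=> LS /subset_leq_card; rewrite cUi => SU AS.
  have := subset_leq_card LS; rewrite leq_eqVlt => /orP[/eqP LSe|lS].
    by left; apply/eqP; rewrite eq_sym eqEcard LS LSe leqnn.
  by right; apply: only => //; card_lia.
have iL_adj S : itv A L (U :\ i) S -> adj A (i |: L) S.
  move=> VS; rewrite adj_sym; case: (cards S VS) => [SL|cS].
    case/and3P: VS => _ _ AS; rewrite SL in AS *.
    apply: adj_up (subsetUr _ _); rewrite ciL; apply/next_levelP; split=> //.
    by move=> c; card_lia.
  have iS := notin_lower VS; case/and3P: VS => LS SU AS.
  have /set0Pn[j jSL] : S :\: L != set0.
    by rewrite -cards_eq0 cardsD (setIidPr LS) cS subSnn.
  have [jS jL] := setDP jSL.
  rewrite (_ : L = S :\ j); first exact: adj_swap.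
  apply/eqP; rewrite eqEcard subsetD1 LS jL /=.
  by rewrite -ltnS -cS (cardsD1 j S) jS.
have lkW : linkable (adj A) W.
  apply: (linkable_insert (w := L) (adj_sym A) Wsum) lk.
    by move=> S VS _; apply: iL_adj.
  move=> a b c.
  have [//|r [Lr rU cr rn]] := level_avoiding (r := [:: a; b; c]) LUi' la dimUi.
  have Vr : itv A L (U :\ i) r by rewrite /itv Lr rU cr Al.
  by exists r; split=> //; apply: iL_adj.
have UW : ~~ W U.
  rewrite /W /= /itv subsetD1 iU !andbF /=; apply: contraTneq dim => ->.
  by rewrite ciL; card_lia.
have Vsum S : nat_of_bool (itv A L U S) = W S + (A #|U| && (S == U)).
  rewrite (itv_split A iU iL) Wsum -addnA; congr (_ + _).
  case: (boolP (itv A (i |: L) U S)) => [/and3P[iLS SU AS]|].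
    have := subset_leq_card SU; rewrite leq_eqVlt => /orP[/eqP cSU|cSU].
      have SUe : S = U by apply/eqP; rewrite eqEcard SU cSU leqnn.
      move: UW; rewrite /W /= negb_or SUe => /andP[_ /negPf->].
      by rewrite -SUe AS eqxx.
    have cS := subset_leq_card iLS; rewrite ciL in cS.
    have cSl : #|S| = #|L|.+1 by apply: only => //; card_lia.
    have -> : (S == i |: L) by rewrite eq_sym eqEcard iLS ciL cSl leqnn.
    by rewrite (_ : S == U = false) ?andbF //; apply: contraTF cSU => /eqP->; rewrite ltnn.
  case: (S =P i |: L) => [->|_]; first by rewrite /itv subxx iLU' ciL Al.
  by case: (S =P U) => [->|_]; rewrite ?andbF // /itv iLU' subxx /= => /negPf->.
case: (boolP (A #|U|)) => AU; last first.
  (* Equality of booleans is read off from equality of their numeric values, with [leq 1] as left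
     inverse. *)
  apply: eq_linkable lkW => S; apply: (@can_inj _ _ nat_of_bool (leq 1)); first by case.
  by rewrite Vsum (negPf AU) addn0.
have U_adj S : #|S| = #|L|.+1 -> S \subset U -> adj A U S.
  move=> cS SU; rewrite adj_sym; apply: adj_up => //; rewrite cS; apply/next_levelP.
  split=> //; first by card_lia.
  by move=> c lc; apply/negP => Ac; have := only c Ac; card_lia.
apply: (linkable_insert (w := L) (z := U) (adj_sym A) _ _ _ lkW).
- by move=> S; rewrite Vsum AU.
- move=> S; rewrite /W /= => /orP[VS SL|/eqP-> _]; last exact: U_adj.
  case: (cards S VS) => [/eqP|cS]; first by rewrite (negPf SL).
  apply: U_adj => //; case/and3P: VS => _ SU _.
  by apply: subset_trans SU (subsetDl _ _).
- move=> a b c.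
  have [//|r [Lr rU cr rn]] := level_avoiding (r := [:: a; b; c]) LUi' la dimUi.
  exists r; split=> //; first by rewrite /W /= /itv Lr rU cr Al.
  by apply: U_adj => //; apply: subset_trans rU (subsetDl _ _).
Qed.

Lemma linkable_dual A L U :
  linkable (adj (dual T A)) (itv (dual T A) (~: U) (~: L)) ->
  linkable (adj A) (itv A L U).
Proof.
apply: (@linkable_map {set T} {set T} _ _ _ _ (@setC T) (@setC T)) => S.
- by rewrite -[S in itv _ _ _ S]setCK itv_dual => ->; rewrite setCK.
- by rewrite itv_dual setCK.
- by move=> R _ _; rewrite -[S in adj _ S]setCK -[R in adj _ _ R]setCK adj_dual.
Qed.

Lemma itv_linkable A L U : L \subset U -> #|L| + 4 <= #|U| ->
  (exists2 a, A a & #|L| < a < #|U|) -> linkable (adj A) (itv A L U).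
Proof.
move=> LU dim; have [m] := ubnP (#|U| - #|L|); elim: m A L U LU dim => // m IH A L U LU dim lm.
case=> a Aa la; have UT : #|U| <= #|T| by apply: max_card.
move: (dim); rewrite leq_eqVlt => /orP[/eqP|] dim5.
  by apply: itv_linkable4 => //; exists a.
have dim' : #|L| + 5 <= #|U| by card_lia.
(* Stated for arbitrary levels and bounds, because it is applied both to the interval and to its
   complement. *)
have step A' L' U' : L' \subset U' -> #|L'| + 5 <= #|U'| ->
    #|U'| - #|L'| <= m -> A' #|L'|.+1 ->
    (forall c, A' c -> #|L'| < c < #|U'| -> c = #|L'|.+1) ->
    linkable (adj A') (itv A' L' U').
  move=> LU' dL' lm' Al only.
  have /properP[_ [i iU iL]] : L' \proper U' by rewrite properEcard LU'; card_lia.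
  apply: (itv_linkable_low LU' iU iL) => //.
  have cUi := card_delete_top iU.
  apply: IH; [exact: bottom_sub_delete | by rewrite cUi; card_lia | by rewrite cUi; card_lia |].
  by exists #|L'|.+1 => //; rewrite cUi; card_lia.
have /properP[_ [i iU iL]] : L \proper U by rewrite properEcard LU; card_lia.
have cUi := card_delete_top iU; have ciL := card_insert_bottom iL.
have [sp|nsp] : splittable A L U \/ ~ splittable A L U.
  rewrite /splittable.
  case: (boolP (has A (iota #|L|.+2 (#|U| - #|L| - 3)))) => [/hasP[c]|/hasPn no].
    by rewrite mem_iota => lc Ac; left; left; exists c => //; card_lia.
  case: (boolP (A #|L|.+1 && A #|U|.-1)) => [/andP[]|nA]; first by left; right.
  right=> -[[c Ac lc]|[Al Au]]; last by rewrite Al Au in nA.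
  by have := no c; rewrite mem_iota Ac => /(_ _)/negP[]//; card_lia.
  have inn : exists2 a, A a & #|L| < a < #|U| by exists a.
  apply: (itv_linkable_split LU iU iL) => //.
    apply: IH; [exact: bottom_sub_delete | by rewrite cUi; card_lia | by rewrite cUi; card_lia |].
    by rewrite cUi; case: sp => [[c Ac lc]|[Ac _]];
      [exists c | exists #|L|.+1] => //; card_lia.
  apply: IH; [exact: insert_bottom_sub | by rewrite ciL; card_lia | by rewrite ciL; card_lia |].
  by rewrite ciL; case: sp => [[c Ac lc]|[_ Ac]];
      [exists c | exists #|U|.-1] => //; card_lia.
(* Without a splittable level set, the inner levels are reduced to one of the two extreme ones, and
   both cannot occur together. *)
have mid c : A c -> #|L| < c < #|U| -> c = #|L|.+1 \/ c = #|U|.-1.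
  move=> Ac lc; case: (boolP (#|L|.+2 <= c <= #|U| - 2)) => [lc'|].
    by case: nsp; left; exists c.
  by card_lia.
case: (boolP (A #|L|.+1)) => Al.
  apply: step => //.
  move=> c Ac lc; case: (mid c Ac lc) => // cU.
  by case: nsp; right; rewrite Al -cU.
have Au : A #|U|.-1.
  by case: (mid a Aa la) => E; rewrite E in Aa; rewrite // Aa in Al.
(* Complementation turns the sole inner level [#|U|.-1] into the one just above the bottom. *)
apply: linkable_dual; apply: step.
- by rewrite setCS.
- by rewrite !card_setC; card_lia.
- by rewrite !card_setC; card_lia.
- by rewrite /dual card_setC (_ : #|T| - _ = #|U|.-1) //; card_lia.
- move=> c; rewrite /dual !card_setC => Ac lc.
  have [//||E|E] := mid (#|T| - c); first by card_lia.
    by rewrite E in Ac; rewrite Ac in Al.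
  by card_lia.
Qed.

End Step.

(** * From intervals back to the graph of the statement *)

Lemma linkable_paired (T : finType) (e : rel T) :
  linkable e predT -> paired_2_coverable e.
Proof.
move=> lk u v x y un.
have [s [t [[p [-> pp lp]] [q [-> qq lq]] c]]] := lk u v x y isT isT isT isT un.
have [_] := count_mem_indicator c; rewrite cat_uniq => /and3P[us /hasPn dis ut].
exists p, q; split.
- by rewrite /is_path pp lp eqxx us.
- by rewrite /is_path qq lq eqxx ut.
- by rewrite disjoint_sym disjoint_has; apply/hasPn => w /dis.
- by move=> w; rewrite -mem_cat -has_pred1 has_count count_cat c.
Qed.

Lemma QJadj_adj n (A : {set 'I_n.+1}) (u v : QJvert A) :
  adj (fun a => (inord a : 'I_n.+1) \in A) (val u) (val v) -> QJadj u v.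
Proof.
have cn (S : {set 'I_n}) : #|S| <= n by rewrite -[n in _ <= n]card_ord max_card.
have next (S R : {set 'I_n}) :
    next_level (fun a => (inord a : 'I_n.+1) \in A) #|S| #|R| ->
    next_in A #|S| #|R|.
  case/next_levelP=> AS AR SR gap; apply/and5P; split; rewrite ?cn //=.
  apply/forallP => c; apply/implyP => cA; apply/negP => /gap.
  by rewrite inord_val cA.
by case/or3P=> [same|/andP[lev ?]|/andP[lev ?]]; apply/or3P;
  [constructor 1 | constructor 2 | constructor 3]; rewrite // next.
Qed.

Theorem theorem9 (n : nat) (A : {set 'I_n.+1}) :
  4 <= n ->
  A != set0 ->
  ord0 \notin A ->
  4 <= #|{: QJvert A}| ->
  paired_2_coverable (@QJadj n A).
Proof.
move=> n4 A0 A_ord0 card4 u v x y un.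
pose lev a := (inord a : 'I_n.+1) \in A.
have cn (S : {set 'I_n}) : #|S| <= n by rewrite -[n in _ <= n]card_ord max_card.
(* If every vertex had size [n], the full set would be the only vertex, contradicting [u != v]. Size
   0 is excluded by [ord0 \notin A]. *)
have [a Aa an] : exists2 a, lev a & 0 < a < n.
  case: (pickP [pred w : QJvert A | #|val w| < n]) => [w /= wn|full].
    exists #|val w|; first exact: (valP w).
    rewrite wn andbT lt0n; apply: contraNneq A_ord0 => w0.
    have := valP w; rewrite /= w0 (_ : inord 0 = ord0) //.
    by apply: val_inj; rewrite /= inordK.
  have valT (w : QJvert A) : val w = setT.
    apply/eqP; rewrite eqEcard subsetT cardsT card_ord.
    by have := full w; rewrite /= ltnNge => /negbFE.
  by move: un; rewrite /= !inE -val_eqE !valT eqxx.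
have lk : linkable (adj lev) (itv lev set0 [set: 'I_n]).
  apply: itv_linkable; rewrite ?sub0set ?cards0 ?cardsT ?card_ord //.
  by exists a.
have vert S : itv lev set0 setT S = ((inord #|S| : 'I_n.+1) \in A).
  by rewrite /itv sub0set subsetT.
have valid b : itv lev set0 setT b -> val (insubd u b) = b.
  by rewrite vert => Vb; rewrite val_insubd Vb.
apply: linkable_paired un.
(* The default [u] of [insubd] is returned only for sets whose level is not in [A], which the
   transport never visits. *)
apply: (@linkable_map {set 'I_n} (QJvert A) (adj lev) _ _ _ (insubd u) val) lk.
- by move=> S VS; rewrite valid.
- by move=> w _; rewrite vert (valP w) valKd.
- by move=> S R VS VR; rewrite -{1}(valid S VS) -{1}(valid R VR) => /QJadj_adj.
Qed.
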